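(* Let $n\ge2$ and let $M=\Gamma\backslash\mathbb{H}^n$ be a compact hyperbolic manifold, with $\Gamma\subset SO_o(n,1)$ discrete, torsion-free and cocompact. If $M$ contains an orientable, compact, totally geodesic hypersurface $\Sigma$, then $H^1(\Gamma,S^k_0\mathbb{R}^{n+1})\neq0$ for every $k\ge1$.
   Context: $SO(n,1)$ is the group of determinant-one linear maps preserving $h(x,x)=x_1^2+\dots+x_n^2-x_{n+1}^2$ on $\mathbb{R}^{n+1}$, acting on $\mathbb{H}^n=\{h(x,x)=-1,x_{n+1}>0\}$ with the induced metric. $S^k_0\mathbb{R}^{n+1}$ denotes the $SO(n,1)$-module given by the trace-free part (trace taken with $h$) of the $k$th symmetric power of $\mathbb{R}^{n+1}$; $\Gamma$ acts by restriction, and $H^1$ denotes group cohomology. *)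

(* Defs.v *)
From mathcomp Require Import all_boot all_order all_algebra all_fingroup.
From mathcomp Require Import reals.
Set Implicit Arguments. Unset Strict Implicit. Unset Printing Implicit Defensive.
Import Order.TTheory GRing.Theory Num.Theory.
Local Open Scope ring_scope.

Section Hyp.
Variables (R : realType) (n : nat).

Definition hsgn (i : 'I_n.+1) : R := if i == ord_max then -1 else 1.

Definition hform (x y : 'cV[R]_n.+1) : R := \sum_i hsgn i * x i 0 * y i 0.

Definition Jh : 'M[R]_n.+1 := \matrix_(i, j) (if i == j then hsgn i else 0).

Definition Hn (x : 'cV[R]_n.+1) : Prop := hform x x = -1 /\ 0 < x ord_max 0.

Definition in_SOn1 (g : 'M[R]_n.+1) : Prop := \det g = 1 /\ g^T *m Jh *m g = Jh.

(* SO_o(n,1): identity component = elements of SO(n,1) preserving H^n *)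
Definition in_SOo (g : 'M[R]_n.+1) : Prop :=
  in_SOn1 g /\ (forall x, Hn x -> Hn (g *m x)).

Definition is_subgroup (G : 'M[R]_n.+1 -> Prop) : Prop :=
  G 1%:M /\ (forall g h, G g -> G h -> G (g *m h)) /\
  (forall g, G g -> g \in unitmx /\ G (invmx g)).

Definition discrete_set (G : 'M[R]_n.+1 -> Prop) : Prop :=
  forall g, G g -> exists2 e : R, 0 < e &
    forall g', G g' -> (forall i j, `|g' i j - g i j| < e) -> g' = g.

Definition torsion_free (G : 'M[R]_n.+1 -> Prop) : Prop :=
  forall g m, G g -> (0 < m)%N -> g ^+ m = 1%:M -> g = 1%:M.

Definition box (B : R) (x : 'cV[R]_n.+1) : Prop := forall i, `|x i 0| <= B.

(* cocompact: there is a compact K (= H^n ∩ closed box) with Γ K = H^n *)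
Definition cocompact (G : 'M[R]_n.+1 -> Prop) : Prop :=
  exists B : R, forall x, Hn x -> exists2 g, G g & box B (g *m x).

(* totally geodesic hyperplane P_v = H^n ∩ v^⊥ for spacelike v *)
Definition hplane (v : 'cV[R]_n.+1) (x : 'cV[R]_n.+1) : Prop :=
  Hn x /\ hform v x = 0.


Definition stab_plane (v : 'cV[R]_n.+1) (g : 'M[R]_n.+1) : Prop :=
  forall x, hplane v x <-> hplane v (g *m x).

(* M = Γ\H^n contains an orientable, compact, (embedded) totally geodesic
   hypersurface Σ = Γ_P \ P, with P = P_v a totally geodesic hyperplane of H^n:
   - embedded: translates of P are equal to P or disjoint from it;
   - compact: the stabiliser Γ_P acts cocompactly on P;
   - orientable: Γ_P preserves the unit normal v (does not send v to -v). *)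
Definition has_tg_hypersurface (G : 'M[R]_n.+1 -> Prop) : Prop :=
  exists v : 'cV[R]_n.+1,
    hform v v = 1 /\
    (forall g, G g -> stab_plane v g \/
         (forall x, hplane v x -> ~ hplane v (g *m x))) /\
    (exists B : R, forall x, hplane v x ->
         exists2 g, G g /\ stab_plane v g & box B (g *m x)) /\
    (forall g, G g -> stab_plane v g -> g *m v = v).

Definition tensor (k : nat) := {ffun 'I_k -> 'I_n.+1} -> R.

Definition tsym k (T : tensor k) : Prop :=
  forall (s : 'S_k) (I : {ffun 'I_k -> 'I_n.+1}), T [ffun i => I (s i)] = T I.

Definition upd2 k (I : {ffun 'I_k -> 'I_n.+1}) (a : 'I_n.+1) :=
  [ffun i : 'I_k => if (i < 2)%N then a else I i].

(* h-trace in the first two slots (h^{-1} = diag(1,..,1,-1)); vacuous if k < 2 *)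
Definition ttracefree k (T : tensor k) : Prop :=
  (2 <= k)%N -> forall I, \sum_(a < n.+1) hsgn a * T (upd2 I a) = 0.

Definition S0 k (T : tensor k) : Prop := tsym T /\ ttracefree T.

Definition tact k (g : 'M[R]_n.+1) (T : tensor k) : tensor k :=
  fun I => \sum_(J : {ffun 'I_k -> 'I_n.+1}) (\prod_(l < k) g (I l) (J l)) * T J.

Definition H1_nonzero (G : 'M[R]_n.+1 -> Prop) (k : nat) : Prop :=
  exists c : 'M[R]_n.+1 -> tensor k,
    (forall g, G g -> S0 (c g)) /\
    (forall g h, G g -> G h -> c (g *m h) = (fun I => c g I + tact g (c h) I)) /\
    ~ (exists2 T : tensor k, S0 T &
         forall g, G g -> c g = (fun I => tact g T I - T I)).

End Hyp.

(* Main.v *)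
(* Let v be the unit normal of a lift of the hypersurface. The orthogonal projection T_w of the k-th
   tensor power of w to the span of the powers of null vectors is a trace-free symmetric tensor with
   <xi^k, T_w> = h(xi, w)^k for null xi, and it depends equivariantly on w. Hence the signed sum of
   the T_w over the lifts w in G v crossed on the way from x0 to g x0 is a cocycle.

   If it were the coboundary of T0, then adding T0 to the sum over the lifts crossed from x0 to x
   would give an equivariant tensor u(x), locally constant off the lifts and jumping by T_w across
   the lift w. By cocompactness |<xi^k, u(x)>| <= C |h(x, xi)|^k for all x and all null xi.
   Along a lift w, where u is constant, this bound forces <xi^k, u> to vanish for the null xi
   orthogonal to w, and to be c h(xi, w)^k for the others. Next to w, on either side, there is another
   lift w'; comparing u on w and w' at a null vector orthogonal to w' gives c = 0 from one side of w
   and c = -1 from the other. *)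
Require Import Defs.
From mathcomp Require Import all_boot all_order all_algebra all_fingroup.
From mathcomp Require Import reals boolp.
From mathcomp Require Import ring lra.
Set Implicit Arguments. Unset Strict Implicit. Unset Printing Implicit Defensive.
Import Order.TTheory GRing.Theory Num.Theory.
Local Open Scope ring_scope.

(** * The Lorentzian form, its null vectors, and geodesics of hyperbolic space *)

Section Form.
Variables (R : realType) (n : nat).
Implicit Types (x y z v w xi : 'cV[R]_n.+1) (g h : 'M[R]_n.+1).

Lemma hformC x y : hform x y = hform y x.
Proof. by apply: eq_bigr => i _; rewrite -!mulrA [x i 0 * _]mulrC. Qed.

Lemma hformDl x y z : hform (x + y) z = hform x z + hform y z.
Proof. by rewrite -big_split; apply: eq_bigr => i _; rewrite !mxE mulrDr mulrDl. Qed.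

Lemma hformZl a x z : hform (a *: x) z = a * hform x z.
Proof. by rewrite mulr_sumr; apply: eq_bigr => i _; rewrite !mxE; ring. Qed.

Lemma hformNl x z : hform (- x) z = - hform x z.
Proof. by rewrite -scaleN1r hformZl mulN1r. Qed.

Lemma hformDr x y z : hform z (x + y) = hform z x + hform z y.
Proof. by rewrite !(hformC z) hformDl. Qed.

Lemma hformZr a x z : hform z (a *: x) = a * hform z x.
Proof. by rewrite !(hformC z) hformZl. Qed.

Lemma hformNr x z : hform z (- x) = - hform z x.
Proof. by rewrite !(hformC z) hformNl. Qed.

Definition hformE := (hformDl, hformDr, hformNl, hformNr, hformZl, hformZr).

Lemma hform_mx x y : hform x y = (x^T *m Jh R n *m y) 0 0.
Proof.
rewrite mxE; apply: eq_bigr => j _; rewrite mxE (bigD1 j) //= !mxE eqxx.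
rewrite big1 => [|i /negbTE nij]; last by rewrite !mxE nij mulr0.
by ring.
Qed.

Lemma hform_delta x j : hform x (delta_mx j 0) = hsgn R j * x j 0.
Proof.
rewrite /hform (bigD1 j) //= big1 ?addr0 => [|i ne]; first by rewrite mxE !eqxx mulr1.
by rewrite mxE (negbTE ne) mulr0.
Qed.

Definition hisom g := g^T *m Jh R n *m g = Jh R n.

Lemma hform_isom g x y : hisom g -> hform (g *m x) (g *m y) = hform x y.
Proof. by move=> gP; rewrite !hform_mx trmx_mul -[in RHS]gP !mulmxA. Qed.

Definition sdot x y : R := \sum_(i | i != ord_max) x i 0 * y i 0.

Lemma hform_sdot x y : hform x y = sdot x y - x ord_max 0 * y ord_max 0.
Proof.
rewrite /hform (bigD1 ord_max) //= /hsgn eqxx addrC mulN1r mulNr; congr (_ - _).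
by apply: eq_bigr => i /negbTE ->; rewrite mul1r.
Qed.

Lemma sdot_ge0 x : 0 <= sdot x x.
Proof. by apply: sumr_ge0 => i _; rewrite -expr2 sqr_ge0. Qed.

Lemma sdot_ge x i : i != ord_max -> x i 0 ^+ 2 <= sdot x x.
Proof.
move=> iP; rewrite /sdot (bigD1 i) //= expr2 lerDl.
by apply: sumr_ge0 => j _; rewrite -expr2 sqr_ge0.
Qed.

Lemma sdot_CS x y : sdot x y ^+ 2 <= sdot x x * sdot y y.
Proof.
set a := sdot x x; set b := sdot y y; set p := sdot x y.
have quad s t : 0 <= s ^+ 2 * a + 2 * s * t * p + t ^+ 2 * b.
  suff -> : s ^+ 2 * a + 2 * s * t * p + t ^+ 2 * b =
      \sum_(i | i != ord_max) (s * x i 0 + t * y i 0) ^+ 2.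
    by apply: sumr_ge0 => i _; rewrite sqr_ge0.
  rewrite /a /b /p /sdot !mulr_sumr -!big_split; apply: eq_bigr => i _ /=; ring.
have b0 : 0 <= b by apply: sdot_ge0.
have a0 : 0 <= a by apply: sdot_ge0.
have [b_eq|bN0] := eqVneq b 0.
  (* For [b = 0] the value of the quadratic form at [(- p, a + 1)] is [- (a + 2) * p ^+ 2], which
     forces [p = 0]. *)
  by have := quad (- p) (a + 1); rewrite b_eq; nra.
have bp : 0 < b by rewrite lt_neqAle eq_sym bN0.
have := quad b (- p).
have -> : b ^+ 2 * a + 2 * b * - p * p + (- p) ^+ 2 * b = b * (a * b - p ^+ 2) by ring.
by rewrite pmulr_rge0 // subr_ge0.
Qed.

Lemma sdot_sub x y : 2 * sdot x y <= sdot x x + sdot y y.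
Proof.
rewrite -subr_ge0 /sdot mulr_sumr -big_split -sumrB.
by apply: sumr_ge0 => i _ /=; have := sqr_ge0 (x i 0 - y i 0); nra.
Qed.

(** Reversed Cauchy-Schwarz inequality: for the spatial products [a], [b], [p] one has
    [(1 + p) ^+ 2 <= (1 + a) * (1 + b)], and the right-hand side is the square of the product of the
    last coordinates. *)
Lemma Hn_hform_le x y : Hn x -> Hn y -> hform x y <= -1.
Proof.
move=> [xx x0] [yy y0]; rewrite !hform_sdot in xx yy *.
have := sdot_CS x y; have := sdot_sub x y.
move: (sdot x x) (sdot y y) (sdot x y) xx yy => a b p; set s := x ord_max 0; set t := y ord_max 0.
rewrite -/s -/t in x0 y0 *.
move=> ha hb h1 h2.
have st : 0 < s * t by rewrite mulr_gt0.
have sq : (1 + p) ^+ 2 <= (s * t) ^+ 2.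
  have ea : s ^+ 2 = 1 + a by lra.
  have eb : t ^+ 2 = 1 + b by lra.
  by rewrite exprMn ea eb; lra.
suff : 1 + p <= s * t by lra.
by rewrite leNgt; apply/negP => hlt; move: sq; apply/negP; rewrite -ltNge ltr_pXn2r // nnegrE; lra.
Qed.

(** On the null cone the last coordinate [t] dominates the others. Cauchy-Schwarz gives
    [t ^+ 2 <= (s * t) ^+ 2 - p ^+ 2]; this factors, one factor being [hform x xi] up to sign and
    the other at most [2 * s * |t|]. *)
Lemma null_bound x xi i : Hn x -> hform xi xi = 0 ->
  `|xi i 0| <= 2 * x ord_max 0 * `|hform x xi|.
Proof.
move=> [xx x0] xixi; rewrite !hform_sdot in xx xixi *.
have cs := sdot_CS x xi.
have [] : `|xi i 0| <= `|xi ord_max 0| /\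
   `|xi ord_max 0| <= 2 * x ord_max 0 * `|sdot x xi - x ord_max 0 * xi ord_max 0|; last first.
  by move=> h1 h2; apply: le_trans h2.
set s := x ord_max 0 in x0 xx *; set t := xi ord_max 0 in xixi *; split.
  have [->|iP] := eqVneq i ord_max; first by [].
  rewrite -ler_sqr ?nnegrE ?normr_ge0 // !real_normK ?num_real //.
  by have := sdot_ge xi iP; lra.
move: cs; rewrite (_ : sdot xi xi = t ^+ 2); last by lra.
rewrite (_ : sdot x x = s ^+ 2 - 1); last by lra.
move: (sdot x xi) => p cs.
have le1 : `|p| <= `|s * t|.
  by rewrite -ler_sqr ?nnegrE ?normr_ge0 // !real_normK ?num_real //; nra.
have prd : t ^+ 2 <= `|p - s * t| * `|p + s * t|.
  rewrite -normrM -normrN; apply: le_trans (ler_norm _); nra.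
have le2 : `|p + s * t| <= 2 * s * `|t|.
  apply: le_trans (ler_normD _ _) _; rewrite normrM (gtr0_norm x0) in le1 *; lra.
have [->|tN0] := eqVneq t 0; first by rewrite normr0; apply: mulr_ge0 => //; lra.
have tp : 0 < `|t| by rewrite normr_gt0.
rewrite -(ler_pM2r tp) -expr2 real_normK ?num_real //.
apply: le_trans prd _; rewrite [leRHS](_ : _ = `|p - s * t| * (2 * s * `|t|)); last by ring.
by rewrite ler_wpM2l.
Qed.

Lemma null_Hn_neq0 x xi : Hn x -> hform xi xi = 0 -> xi != 0 -> hform x xi != 0.
Proof.
move=> xP xi0; apply: contra => /eqP h0; apply/eqP/matrixP => i j.
have := null_bound i xP xi0; rewrite h0 normr0 mulr0 normr_le0 ord1 => /eqP ->.
by rewrite mxE.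
Qed.

Lemma Hn_of_neg y z : Hn y -> hform z z = -1 -> hform y z < 0 -> Hn z.
Proof.
move=> yP zz yz; split => //; rewrite ltNge; apply/negP => z0.
have zm : z ord_max 0 != 0.
  apply/eqP => z00; move: zz; rewrite hform_sdot z00 mulr0 subr0.
  by have := sdot_ge0 z; lra.
have /(Hn_hform_le yP) : Hn (- z).
  split; first by rewrite !hformE; lra.
  by rewrite mxE oppr_gt0 lt_neqAle zm.
by rewrite hformNr; lra.
Qed.

(** Cauchy-Schwarz for the spatial parts bounds [(s * t) ^+ 2] by [(s ^+ 2 - 1) * b]: a timelike
    vector has a positive semidefinite orthogonal complement. *)
Lemma Hn_orth_ge0 x z : Hn x -> hform x z = 0 -> 0 <= hform z z.
Proof.
move=> [xx x0]; rewrite !hform_sdot in xx * => xz.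
have := sdot_CS x z; set s := x ord_max 0 in x0 xx xz *; set t := z ord_max 0 in xz *.
rewrite (_ : sdot x z = s * t); last by lra.
rewrite (_ : sdot x x = s ^+ 2 - 1); last by lra.
have := sdot_ge0 z; move: (sdot z z) => b b0 h.
have s1 : 0 < s ^+ 2 by rewrite exprn_gt0.
have : s ^+ 2 * t ^+ 2 <= s ^+ 2 * b by nra.
by rewrite ler_pM2l // subr_ge0 expr2.
Qed.

Lemma Hn_orth_eq0 x z : Hn x -> hform x z = 0 -> hform z z = 0 -> z = 0.
Proof.
move=> xP xz zz; apply/eqP/negPn/negP => /(null_Hn_neq0 xP zz).
by rewrite xz eqxx.
Qed.

(** Two linear conditions on a space of dimension at least 3 leave a nonzero solution. *)
Lemma orth2 w x : (2 <= n)%N -> exists2 z, z != 0 & hform w z = 0 /\ hform x z = 0.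
Proof.
move=> n2; pose A : 'M[R]_(n.+1, 1 + 1) := Jh R n *m row_mx w x.
have : kermx A != 0.
  rewrite kermx_eq0 -row_leq_rank -ltnNge; apply: leq_ltn_trans (rank_leq_col _) _.
  by rewrite ltnS.
case/rowV0Pn => r /sub_kermxP rA rN0; exists r^T; first by rewrite trmx_eq0.
have E y : (r *m Jh R n *m y) = 0 -> hform y r^T = 0.
  by move=> e; rewrite hformC hform_mx trmxK e mxE.
move: rA; rewrite /A mulmxA mul_mx_row -[0](row_mx0 R 1 1 1) => /eq_row_mx[e1 e2].
by split; apply: E.
Qed.

(** Removing the [x]-component of [z] leaves a spacelike or zero vector. In the first case [e] is
    its normalisation; in the second [m = 0] and any unit vector orthogonal to [w] and [x]
    serves. *)
Lemma orth_decomp w x z : (2 <= n)%N -> Hn x -> hform w w = 1 -> hform w x = 0 -> hform w z = 0 ->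
  exists e, [/\ hform e e = 1, hform w e = 0, hform x e = 0 &
    exists2 m, 0 <= m & z = (- hform x z) *: x + m *: e].
Proof.
move=> n2 xP ww wx wz; have [xx _] := xP.
have unit y : y != 0 -> hform w y = 0 -> hform x y = 0 ->
    exists2 m, 0 < m & exists e, [/\ hform e e = 1, hform w e = 0, hform x e = 0 & y = m *: e].
  move=> y0 wy xy; have yy : 0 < hform y y.
    rewrite lt_neqAle (Hn_orth_ge0 xP xy) andbT; apply: contra y0 => /eqP yy.
    by rewrite (Hn_orth_eq0 xP xy).
  have m0 : 0 < Num.sqrt (hform y y) by rewrite sqrtr_gt0.
  exists (Num.sqrt (hform y y)) => //; exists ((Num.sqrt (hform y y))^-1 *: y).
  rewrite !hformE wy xy !mulr0; split=> //; last by rewrite scalerA divff ?scale1r ?gt_eqF.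
  by rewrite mulrA -invfM -expr2 sqr_sqrtr ?ltW // mulVf ?gt_eqF.
pose z1 := z + hform x z *: x.
have wz1 : hform w z1 = 0 by rewrite !hformE wz wx; ring.
have xz1 : hform x z1 = 0 by rewrite !hformE xx; ring.
have zE : z = (- hform x z) *: x + z1 by rewrite /z1 scaleNr addrCA addNr addr0.
have [z10|z1N] := eqVneq z1 0.
  have [y y0 [wy xy]] := orth2 w x n2.
  have [_ _ [e [ee we xe _]]] := unit _ y0 wy xy.
  by exists e; split=> //; exists 0 => //; rewrite scale0r {1}zE z10.
have [m m0 [e [ee we xe z1E]]] := unit _ z1N wz1 xz1.
by exists e; split => //; exists m; rewrite -?z1E // ltW.
Qed.

(** The geodesic from [x] with unit tangent [e], where [s] is the exponential of arc length. With
    this parameter [s *: geo x e s] is polynomial in [s], and the endpoints are the null directions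
    [x + e] and [x - e]. *)
Definition geo x e s := (s / 2) *: (x + e) + (s^-1 / 2) *: (x - e).

Lemma geo_Hn x e s : Hn x -> hform e e = 1 -> hform x e = 0 -> 0 < s -> Hn (geo x e s).
Proof.
move=> xP ee xe s0; have [xx _] := xP; have ex : hform e x = 0 by rewrite hformC.
apply: (Hn_of_neg xP); rewrite /geo !hformE ?ee xe ?ex xx.
  by field; rewrite gt_eqF.
have : 0 < s^-1 by rewrite invr_gt0.
by lra.
Qed.

Lemma geo_orth w x e s : hform w x = 0 -> hform w e = 0 -> hform w (geo x e s) = 0.
Proof. by move=> wx we; rewrite /geo !hformE wx we; ring. Qed.

Lemma geo_connect w x y : (2 <= n)%N -> hform w w = 1 -> hplane w x -> hplane w y ->
  exists e s, [/\ hform e e = 1, hform w e = 0, hform x e = 0, 0 < s & y = geo x e s].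
Proof.
move=> n2 ww [xP wx] [yP wy]; have [xx _] := xP; have [yy _] := yP.
have [e [ee we xe [m m0 yE]]] := orth_decomp n2 xP ww wx wy.
have ex : hform e x = 0 by rewrite hformC.
have := Hn_hform_le xP yP; set k := - hform x y in yE * => k1'.
have k1 : 1 <= k by rewrite /k; lra.
have km : k ^+ 2 = 1 + m ^+ 2.
  by move: yy; rewrite yE !hformE xx ee xe ex; nra.
have s0 : 0 < k + m by lra.
exists e, (k + m); split=> //; rewrite /geo.
(* As [k ^+ 2 - m ^+ 2 = 1], the numbers [k] and [m] are the hyperbolic cosine and sine of the
   logarithm of [k + m]. *)
have -> : (k + m)^-1 = k - m by apply: (mulfI (lt0r_neq0 s0)); rewrite divff ?gt_eqF //; nra.
by rewrite {1}yE !scalerDr !scalerN addrACA -scalerBl -scalerDl; congr (_ *: _ + _ *: _); field.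
Qed.

(* With [w' = al w + la x + m e] the equation for the parameter of the geodesic [geo x e] is
   quadratic with discriminant 1. *)
Lemma ideal_point w w' x : (2 <= n)%N -> hplane w x -> hform w w = 1 -> hform w' w' = 1 ->
  w' != w -> w' != - w ->
  exists d y, [/\ d = 1 \/ d = -1, hplane w y & hform w' (d *: w + y) = 0].
Proof.
move=> n2 [xP wx] ww ww' neq neqN; have [xx _] := xP.
set al := hform w w'.
have [|e [ee we xe [m m0 zE]]] := @orth_decomp w x (w' - al *: w) n2 xP ww wx.
  by rewrite !hformE ww -/al; ring.
set la := - hform x _ in zE.
have w'E : w' = al *: w + la *: x + m *: e by rewrite -addrA -zE addrC subrK.
have [ew ex xw] : [/\ hform e w = 0, hform e x = 0 & hform x w = 0] by rewrite hformC we hformC xe hformC wx.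
have nrm : al ^+ 2 - la ^+ 2 + m ^+ 2 = 1.
  by move: ww'; rewrite {1 2}w'E !hformE xx ee ww ew ex xw xe we wx; nra.
have main d s : 0 < s -> d = 1 \/ d = -1 ->
    s ^+ 2 * (m - la) + 2 * d * al * s - (la + m) = 0 ->
    exists d y, [/\ d = 1 \/ d = -1, hplane w y & hform w' (d *: w + y) = 0].
  move=> s0 dP q; exists d, (geo x e s); split=> //.
    by split; [apply: geo_Hn|apply: geo_orth].
  apply: (mulfI (lt0r_neq0 s0)); rewrite mulr0.
  rewrite /geo w'E !hformE xx ee ww ew ex xw xe we wx.
  transitivity ((s ^+ 2 * (m - la) + 2 * d * al * s - (la + m)) / 2); last by rewrite q mul0r.
  by field; rewrite gt_eqF.
(* Here the equation is linear. Then [al ^+ 2 = 1], and [la = 0] would give [w' = w] or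
   [w' = - w]. *)
have [A0|AN] := eqVneq (m - la) 0.
  have al2 : al ^+ 2 = 1 by nra.
  have laN : la != 0.
    apply/eqP => la0; have m00 : m = 0 by lra.
    move/eqP: al2; rewrite sqrf_eq1 => /orP[] /eqP al1.
      by case/eqP: neq; rewrite w'E al1 la0 m00 !scale0r !addr0 scale1r.
    by case/eqP: neqN; rewrite w'E al1 la0 m00 !scale0r !addr0 scaleN1r.
  have lap : 0 < la by rewrite lt_neqAle eq_sym laN /=; lra.
  apply: (main al la) => //; first by move/eqP: al2; rewrite sqrf_eq1 => /orP[]/eqP->; [left|right].
  by rewrite A0; nra.
(* For [d = - sg] the roots are [sg * c / (m - la)] with [c] equal to [al + 1] or [al - 1]; choosing
   [sg] makes a nonzero one positive. *)
have root c sg : c = al + 1 \/ c = al - 1 -> sg = 1 \/ sg = -1 -> 0 < sg * c / (m - la) ->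
    exists d y, [/\ d = 1 \/ d = -1, hplane w y & hform w' (d *: w + y) = 0].
  move=> cP sgP s0.
  apply: (main (- sg) _ s0); first by case: sgP => ->; rewrite ?opprK; [right|left].
  have sg2 : sg ^+ 2 = 1 by case: sgP => ->; rewrite ?expr1n ?sqrrN ?expr1n.
  apply: (mulfI AN); rewrite mulr0.
  rewrite [LHS](_ : _ = sg ^+ 2 * c ^+ 2 - 2 * sg ^+ 2 * al * c + (la ^+ 2 - m ^+ 2)); last by field.
  by rewrite sg2; case: cP => ->; lra.
have pick c : c != 0 -> c = al + 1 \/ c = al - 1 ->
    exists d y, [/\ d = 1 \/ d = -1, hplane w y & hform w' (d *: w + y) = 0].
  move=> cN cP; have : c / (m - la) != 0 by rewrite mulf_neq0 ?invr_eq0.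
  case/lt_total/orP => hs.
    by apply: (root c (-1)) => //; [right|rewrite -mulrA mulN1r; lra].
  by apply: (root c 1) => //; [left|rewrite mul1r].
have [c0|cN] := eqVneq (al + 1) 0; last by apply: (pick (al + 1)) => //; left.
by apply: (pick (al - 1)); [lra|right].
Qed.

End Form.

(** * Orthogonal projection and finite spanning families *)

Section LinearAlgebra.
Variable R : realType.

Lemma trmx_mul_eq0 m p (M : 'M[R]_(m, p)) : M^T *m M = 0 -> M = 0.
Proof.
move=> MM; apply/matrixP => i j; rewrite !mxE; apply/eqP; rewrite -sqrf_eq0.
have /eqP : (M^T *m M) j j = 0 by rewrite MM mxE.
rewrite mxE psumr_eq0 => [/allP /(_ i)|l _]; last by rewrite mxE -expr2 sqr_ge0.
by rewrite mem_index_enum mxE -expr2 => /(_ isT).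
Qed.

(** Least squares: [c *m A] is the Euclidean projection of [y] to the row space of [A]. It exists
    because every column killed by [A *m A^T] is already killed by [A^T]. *)
Lemma normal_equation m p (A : 'M[R]_(m, p)) (y : 'rV[R]_p) :
  exists c : 'rV_m, c *m A *m A^T = y *m A^T.
Proof.
have : (A^T <= A *m A^T)%MS.
  rewrite submxE; apply/eqP/trmx_mul_eq0; set C := cokermx _.
  by rewrite trmx_mul trmxK -!mulmxA [A *m _]mulmxA mulmx_coker mulmx0.
move/submxP => [D E]; exists (y *m D).
by rewrite -!mulmxA -E.
Qed.

(** As long as some vector of [P] is outside the row space it is appended; the induction is on a
    bound [d] for the missing rank. *)
Lemma finite_spanning p (P : 'rV[R]_p -> Prop) :
  exists m (A : 'M[R]_(m, p)), (forall i, P (row i A)) /\ forall y, P y -> (y <= A)%MS.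
Proof.
suff H d m (A : 'M[R]_(m, p)) : (p <= \rank A + d)%N -> (forall i, P (row i A)) ->
    exists m (A : 'M[R]_(m, p)), (forall i, P (row i A)) /\ forall y, P y -> (y <= A)%MS.
  by apply: (H p 0%N 0) => [|[]//]; rewrite leq_addl.
elim: d m A => [|d IH] m A rA PA.
  exists m, A; split=> // y _; apply: submx_full; rewrite /row_full eqn_leq rank_leq_col.
  by rewrite addn0 in rA.
have [[y [Py yA]]|no] := pselect (exists y, P y /\ ~~ (y <= A)%MS); last first.
  by exists m, A; split=> // y Py; apply/negPn/negP => yA; apply: no; exists y.
apply: (IH _ (col_mx A y)).
  apply: (leq_trans rA); rewrite addnS -addSn leq_add2r; apply: rank_ltmx.
  by rewrite ltmxE col_mx_sub submx_refl yA andbT -addsmxE addsmxSl.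
by move=> i; case: (split_ordP i) => j ->; rewrite ?rowKu ?rowKd // (ord1 j) row_id.
Qed.

End LinearAlgebra.

(** The first two slots carry the factor [x a 0] and the others do not see [a], so the trace of a
    power of [x] is a multiple of [hform x x]. *)
Lemma prod_upd2 (R : realType) n k (x : 'cV[R]_n.+1) (I : {ffun 'I_k -> 'I_n.+1}) :
  (2 <= k)%N -> exists c, forall a, \prod_l x (upd2 I a l) 0 = x a 0 ^+ 2 * c.
Proof.
case: k I => [|[|k]] // I _; exists (\prod_(l < k) x (I (lift ord0 (lift ord0 l))) 0) => a.
rewrite !big_ord_recl !ffunE /= mulrA; congr (_ * _).
by apply: eq_bigr => l _; rewrite ffunE.
Qed.

(** * Powers of null vectors, and the equivariant tensors [T w] *)

Section Tensors.
Variables (R : realType) (n k : nat).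
Implicit Types (x y z v w xi : 'cV[R]_n.+1) (g h : 'M[R]_n.+1) (T : tensor R n k).

Lemma isom_unitmx g : hisom g -> g \in unitmx.
Proof.
move=> gP; have JJ : Jh R n *m Jh R n = 1%:M.
  apply/matrixP => i j; rewrite mxE (bigD1 i) //= !mxE eqxx.
  rewrite big1 => [|l /negbTE nl]; last by rewrite !mxE eq_sym nl mul0r.
  by rewrite /hsgn; case: (i == j); case: ifP => _; rewrite /=; ring.
suff /mulmx1_unit[] : Jh R n *m g^T *m Jh R n *m g = 1%:M by [].
by rewrite -!mulmxA [g^T *m _]mulmxA gP.
Qed.

Lemma isom_invmx g : hisom g -> hisom (invmx g).
Proof.
move=> gP; have gu := isom_unitmx gP.
rewrite /hisom -{1}gP !mulmxA -trmx_mul mulmxV // trmx1 mul1mx -mulmxA.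
by rewrite mulmxV // mulmx1.
Qed.

(** Lowering the index with [h] turns the form into the Euclidean product. *)
Definition flip xi : 'cV[R]_n.+1 := \col_i (hsgn R i * xi i 0).

Lemma flipK : involutive flip.
Proof.
move=> xi; apply/matrixP => i j; rewrite !mxE ord1 mulrA /hsgn.
by case: ifP => _; rewrite ?mulrNN ?mul1r.
Qed.

Lemma hform_flip xi w : \sum_i flip xi i 0 * w i 0 = hform xi w.
Proof. by apply: eq_bigr => i _; rewrite mxE. Qed.

Lemma flip_null xi : hform (flip xi) (flip xi) = hform xi xi.
Proof. by rewrite -hform_flip flipK; apply: eq_bigr => i _; rewrite mxE; ring. Qed.

Definition tpow xi : tensor R n k := fun I => \prod_l xi (I l) 0.

Lemma sum_tpow xi w : \sum_I tpow xi I * tpow w I = (\sum_i xi i 0 * w i 0) ^+ k.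
Proof.
rewrite -[k in RHS]card_ord -prodr_const bigA_distr_bigA.
by apply: eq_bigr => I _; rewrite -big_split.
Qed.

Lemma tact_tpow g xi : tact g (tpow xi) = tpow (g *m xi).
Proof.
apply: funext => I; rewrite /tpow.
under [RHS]eq_bigr do rewrite mxE.
by rewrite bigA_distr_bigA; apply: eq_bigr => J _; rewrite -big_split.
Qed.

(* [T] contracted with [k] copies of [xi], indices being lowered with [h] *)
Definition ev T xi := \sum_I tpow (flip xi) I * T I.

(** Slot by slot this is the invariance of [hform] applied to [xi] and a basis vector, whose image
    is a column of [g]. *)
Lemma ev_tact g T xi : hisom g -> ev (tact g T) (g *m xi) = ev T xi.
Proof.
move=> gP; rewrite /ev /tact; under eq_bigr do rewrite mulr_sumr.
rewrite exchange_big; apply: eq_bigr => J _ /=.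
transitivity ((\prod_l \sum_i flip (g *m xi) i 0 * g i (J l)) * T J).
  rewrite bigA_distr_bigA mulr_suml; apply: eq_bigr => I _.
  by rewrite mulrA -big_split.
congr (_ * _); apply: eq_bigr => l _; rewrite [RHS]mxE.
have := hform_isom xi (delta_mx (J l) 0) gP.
rewrite -hform_flip => E; rewrite -(hform_delta xi) -E.
apply: eq_bigr => i _; congr (_ * _).
by rewrite -colE mxE.
Qed.

Definition nullspan T := exists2 s : seq (R * 'cV[R]_n.+1),
  forall p, p \in s -> hform p.2 p.2 = 0 & T = (fun I => \sum_(p <- s) p.1 * tpow p.2 I).

Lemma nullspan_S0 T : nullspan T -> S0 T.
Proof.
case=> s sP ->; split=> [t I|k2 I].
  apply: eq_bigr => p _; congr (_ * _); rewrite /tpow [RHS](reindex_inj (@perm_inj _ t)).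
  by apply: eq_bigr => l _; rewrite ffunE.
under eq_bigr do rewrite mulr_sumr.
rewrite exchange_big big_seq big1 //= => p /sP p0.
have [c cE] := prod_upd2 p.2 I k2.
transitivity (hform p.2 p.2 * (p.1 * c)); last by rewrite p0 mul0r.
by rewrite mulr_suml; apply: eq_bigr => a _; rewrite /tpow cE; ring.
Qed.

Lemma nullspan_tact g T : hisom g -> nullspan T -> nullspan (tact g T).
Proof.
move=> gP [s sP ->]; exists [seq (p.1, g *m p.2) | p <- s].
  by move=> _ /mapP[p /sP p0 ->] /=; rewrite hform_isom.
apply: funext => I; rewrite big_map /= /tact.
under [LHS]eq_bigr do rewrite mulr_sumr.
rewrite exchange_big; apply: eq_bigr => p _; rewrite -tact_tpow mulr_sumr.
by apply: eq_bigr => J _; rewrite mulrCA.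
Qed.

Lemma nullspanB T T' : nullspan T -> nullspan T' -> nullspan (fun I => T I - T' I).
Proof.
move=> [s sP ->] [s' sP' ->]; exists (s ++ [seq (- p.1, p.2) | p <- s']).
  by move=> p; rewrite mem_cat => /orP[/sP//|/mapP[q /sP' ? ->]].
apply: funext => I; rewrite big_cat big_map /= -sumrN; congr (_ + _).
by apply: eq_bigr => p _; rewrite mulNr.
Qed.

(** The difference is Euclidean-orthogonal to all powers of null vectors, since [flip] preserves the
    null cone. Being a combination of such powers, it is orthogonal to itself. *)
Lemma nullspan_inj T T' : nullspan T -> nullspan T' ->
  (forall xi, hform xi xi = 0 -> ev T xi = ev T' xi) -> T = T'.
Proof.
move=> sT sT' E; have [s sP DE] := nullspanB sT sT'.
pose D I := T I - T' I.
have evD xi : hform xi xi = 0 -> \sum_I tpow xi I * D I = 0.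
  move=> xi0; under eq_bigr do rewrite mulrBr; rewrite sumrB.
  by have := E (flip xi); rewrite flip_null /ev flipK => -> //; rewrite subrr.
have DD : \sum_I D I ^+ 2 = 0.
  transitivity (\sum_I \sum_(p <- s) p.1 * (tpow p.2 I * D I)).
    apply: eq_bigr => I _; rewrite expr2.
    rewrite [X in X * _](congr1 (fun f => f I) DE) mulr_suml.
    by apply: eq_bigr => p _; rewrite mulrA.
  rewrite exchange_big big_seq big1 //= => p /sP p0.
  by rewrite -mulr_sumr evD ?mulr0.
apply: funext => I; apply/eqP; rewrite -subr_eq0 -sqrf_eq0; apply/eqP.
exact: psumr_eq0P (fun I _ => sqr_ge0 (D I)) DD _ isT.
Qed.

(* The Euclidean projection of [w]^{(x)k} to the span of the powers of null vectors; as [flip]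
   preserves the null cone it is also the [h]-orthogonal projection, hence it is equivariant. *)
Lemma zonal_exists w : exists2 T, nullspan T &
  forall xi, hform xi xi = 0 -> ev T xi = hform xi w ^+ k.
Proof.
(* Tensors become row vectors, so that the Euclidean pairing is a matrix product. *)
pose vec T : 'rV[R]_#|{ffun 'I_k -> 'I_n.+1}| := \row_j T (enum_val j).
have dotE T T' : (vec T *m (vec T')^T) 0 0 = \sum_I T I * T' I.
  rewrite mxE (reindex (@enum_val _ {ffun 'I_k -> 'I_n.+1})) /=; last first.
    exact/onW_bij/enum_val_bij.
  by apply: eq_bigr => i _; rewrite !mxE.
have [m [A [PA AP]]] := finite_spanning
  (fun r => exists2 xi, hform xi xi = 0 & r = vec (tpow xi)).
have [c cE] := normal_equation A (vec (tpow w)).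
have /choice[xi xiP] i : exists x, hform x x = 0 /\ row i A = vec (tpow x).
  by have [x ? ?] := PA i; exists x.
pose s := [seq (c 0 i, xi i) | i <- enum 'I_m].
pose T : tensor R n k := fun I => \sum_(p <- s) p.1 * tpow p.2 I.
exists T; first by exists s => // p /mapP[i _ ->]; have [] := xiP i.
have vT : vec T = c *m A.
  apply/rowP => j; rewrite !mxE /T big_map big_enum; apply: eq_bigr => i _ /=.
  by congr (_ * _); have [_ /rowP/(_ j)] := xiP i; rewrite !mxE.
move=> x x0; rewrite -hform_flip -sum_tpow /ev -!dotE.
(* The power of [flip x] is in the row space of [A], so it pairs equally with the power of [w] and
   with its projection. *)
have /submxP[D ->] : (vec (tpow (flip x)) <= A)%MS by apply: AP; exists (flip x); rewrite ?flip_null.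
rewrite -!mulmxA; congr ((D *m _) 0 0); apply: trmx_inj.
by rewrite !trmx_mul !trmxK vT cE.
Qed.

(** Each [T w] is picked by choice, yet equivariance holds: [T (g *m w)] and [tact g (T w)] lie in
    the null span and agree on null vectors, hence are equal by [nullspan_inj]. *)
Lemma zonal : exists T : 'cV[R]_n.+1 -> tensor R n k,
  [/\ forall w, S0 (T w),
      forall w xi, hform xi xi = 0 -> ev (T w) xi = hform xi w ^+ k &
      forall g w, hisom g -> T (g *m w) = tact g (T w)].
Proof.
have /choice[T TP] w : exists T, nullspan T /\
    forall xi, hform xi xi = 0 -> ev T xi = hform xi w ^+ k.
  by have [T ? ?] := zonal_exists w; exists T.
exists T; split=> [w|w|g w gP]; [by have [/nullspan_S0] := TP w|by have [] := TP w|].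
have [sp _] := TP w.
apply: nullspan_inj (nullspan_tact gP sp) _; first by have [] := TP (g *m w).
move=> xi xi0; have gu := isom_unitmx gP.
rewrite (proj2 (TP _)) // -{1 2}[xi](mulKVmx gu) ev_tact // hform_isom //.
by rewrite (proj2 (TP _)) // hform_isom //; apply: isom_invmx.
Qed.

End Tensors.

(** * Polynomials whose growth is that of a monomial *)

Section Polynomials.
Variable R : realType.
Implicit Types F : {poly R}.

Lemma horner_bound F : exists2 C, 0 <= C & forall s, 0 < s <= 1 -> `|F.[s]| <= C.
Proof.
exists (\sum_(i < size F) `|F`_i|); first by apply: sumr_ge0.
move=> s /andP[s0 s1]; rewrite horner_coef; apply: le_trans (ler_norm_sum _ _ _) _.
apply: ler_sum => i _; rewrite normrM -[leRHS]mulr1 ler_wpM2l // normrX.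
by rewrite exprn_ile1 // gtr0_norm.
Qed.

Lemma le_linear_eq0 (a C : R) : (forall s, 0 < s <= 1 -> `|a| <= C * s) -> a = 0.
Proof.
move=> H; apply/eqP/negPn/negP; rewrite -normr_gt0; set b := `|a| in H * => b0.
have Cp : 0 < C by have := H 1; rewrite ltr01 lexx => /(_ isT); lra.
(* At this point of the interval [C * s] is less than [b / 2], against the hypothesis. *)
have d0 : 0 < b / (2 * (C + b)) by apply: divr_gt0; lra.
have := H (b / (2 * (C + b))); rewrite d0 /= ler_pdivrMr ?mul1r; last by lra.
have -> : b <= 2 * (C + b) by lra.
move=> /(_ isT); rewrite mulrA ler_pdivlMr; last by lra.
nra.
Qed.

(** Letting [s] tend to 0 kills the constant term; dividing by [s] lowers [k] by one. *)
Lemma vanishing_order F k C :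
  (forall s, 0 < s <= 1 -> `|F.[s]| <= C * s ^+ k) -> forall i, (i < k)%N -> F`_i = 0.
Proof.
elim: k F => [|k IH] F H // i; elim/poly_ind: F H => [|F1 c _] H; first by rewrite coef0.
have [C1 C10 F1b] := horner_bound F1.
have Fs s : (F1 * 'X + c%:P).[s] = F1.[s] * s + c by rewrite !hornerE.
have c0 : c = 0.
  apply: (@le_linear_eq0 _ (C1 + `|C|)) => s s01; have /andP[s0 s1] := s01.
  rewrite [X in `|X|](_ : c = (F1 * 'X + c%:P).[s] - F1.[s] * s); last by rewrite Fs; ring.
  apply: le_trans (ler_normB _ _) _; rewrite mulrDl addrC lerD //.
    by rewrite normrM (gtr0_norm s0) ler_wpM2r ?F1b // ltW.
  apply: le_trans (H s s01) _; apply: le_trans (ler_norm _) _; rewrite normrM ler_wpM2l //.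
  rewrite gtr0_norm ?exprn_gt0 // exprS -[leRHS]mulr1 ler_wpM2l ?(ltW s0) //.
  by rewrite exprn_ile1 // ltW.
have F1P s : 0 < s <= 1 -> `|F1.[s]| <= C * s ^+ k.
  move=> s01; have /andP[s0 s1] := s01; have := H s s01.
  by rewrite Fs c0 addr0 normrM (gtr0_norm s0) exprSr mulrA ler_pM2r.
rewrite c0 addr0 coefMX; case: i => [|i] //= ik.
exact: IH F1P _ ik.
Qed.

(** The bound near 0 kills the coefficients below [k], and the bound near infinity kills those
    above. *)
Lemma monomial_of_bound F k C :
  (forall s, 0 < s -> `|F.[s]| <= C * s ^+ k) -> F = F`_k *: 'X^k.
Proof.
move=> H; apply/polyP => i; rewrite coefZ coefXn.
have [->|ne] := eqVneq i k; first by rewrite mulr1.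
rewrite mulr0; have [ik|ki] := ltnP i k.
  by apply: (vanishing_order _ ik) => [s /andP[s0 _]]; apply: H.
have {ne}ki : (k < i)%N by rewrite ltn_neqAle eq_sym ne.
have [big|iF] := leqP (size F) i; first by rewrite nth_default.
case sF: (size F) iF => [|m] //; rewrite ltnS => im.
have km : (k <= m)%N := ltnW (leq_trans ki im).
(* Reversing the coefficients exchanges 0 and infinity. *)
pose G := \poly_(j < m.+1) F`_(m - j).
have GP s : 0 < s <= 1 -> `|G.[s]| <= C * s ^+ (m - k).
  move=> /andP[s0 s1]; have sN : s != 0 by rewrite gt_eqF.
  have -> : G.[s] = s ^+ m * F.[s^-1].
    rewrite horner_poly horner_coef sF mulr_sumr (reindex_inj rev_ord_inj) /=.
    apply: eq_bigr => j _; have jm : (j <= m)%N by rewrite -ltnS.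
    rewrite subSS subKn // mulrCA; congr (_ * _).
    have -> : s ^+ m = s ^+ (m - j) * s ^+ j by rewrite -exprD subnK.
    by rewrite -mulrA -exprMn divff // expr1n mulr1.
  rewrite normrM gtr0_norm ?exprn_gt0 // -[in leLHS](subnK km) exprD -mulrA mulrC.
  rewrite ler_pM2r ?exprn_gt0 // mulrC -ler_pdivlMr ?exprn_gt0 // -exprVn.
  by apply: H; rewrite invr_gt0.
have := vanishing_order GP (i := (m - i)%N).
by rewrite ltn_sub2l ?(leq_trans ki) // coef_poly ltnS leq_subr subKn // => /(_ isT).
Qed.

Lemma ev_poly n k (T : tensor R n k) (x0 x1 x2 : 'cV[R]_n.+1) :
  exists F, forall s, F.[s] = ev T (x0 + s *: x1 + s ^+ 2 *: x2).
Proof.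
exists (\sum_(I : {ffun 'I_k -> 'I_n.+1}) (\prod_l (hsgn R (I l) *:
  ((x0 (I l) 0)%:P + (x1 (I l) 0)%:P * 'X + (x2 (I l) 0)%:P * 'X^2))) * (T I)%:P) => s.
rewrite horner_sum; apply: eq_bigr => I _; rewrite hornerM hornerC horner_prod; congr (_ * _).
by apply: eq_bigr => l _; rewrite !hornerE !mxE /=; ring.
Qed.

End Polynomials.

(** * Points on hyperplanes, segments, and bounds for isometries *)

Section HyperbolicPoints.
Variables (R : realType) (n : nat).
Implicit Types (x y z v w xi : 'cV[R]_n.+1) (g h : 'M[R]_n.+1).

Lemma hplane_inhabited w : hform w w = 1 -> exists x, hplane w x.
Proof.
rewrite hform_sdot => ww; set t := w ord_max 0 in ww.
have r2 : Num.sqrt (1 + t ^+ 2) ^+ 2 = 1 + t ^+ 2 by rewrite sqr_sqrtr //; have := sqr_ge0 t; lra.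
have : 0 < Num.sqrt (1 + t ^+ 2) by rewrite sqrtr_gt0; have := sqr_ge0 t; lra.
set r := Num.sqrt _ in r2 * => r0.
have ww' : sdot w w = r ^+ 2 by lra.
(* This is the last basis vector projected orthogonally to [w] and rescaled to norm -1. *)
pose x : 'cV[R]_n.+1 := \col_i if i == ord_max then r else t / r * w i 0.
have xm : x ord_max 0 = r by rewrite mxE eqxx.
have wx : sdot w x = t / r * sdot w w.
  rewrite /sdot mulr_sumr; apply: eq_bigr => i /negbTE im; rewrite mxE im; ring.
have xx : sdot x x = (t / r) ^+ 2 * sdot w w.
  rewrite /sdot mulr_sumr; apply: eq_bigr => i /negbTE im; rewrite mxE im; ring.
exists x; split; last by rewrite hform_sdot wx xm ww' -/t; field; rewrite gt_eqF.
split; last by rewrite xm.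
rewrite hform_sdot xx xm ww' -expr2 expr_div_n mulfVK ?expf_neq0 ?gt_eqF //; lra.
Qed.

(** The chord is projected radially to the hyperboloid. As [hform x y <= -1], its points have norm
    at most -1, so the factor [r] is at most 1, which keeps the projected chord in any box
    containing its ends. *)
Lemma segment_Hn x y t : Hn x -> Hn y -> 0 <= t <= 1 ->
  exists2 r, 0 < r <= 1 & Hn (r *: ((1 - t) *: x + t *: y)).
Proof.
move=> xP yP /andP[t0 t1]; have xy := Hn_hform_le xP yP.
have [xx x0] := xP; have [yy y0] := yP; have yx : hform y x = hform x y by rewrite hformC.
set z := _ + _.
have zz : hform z z <= -1.
  rewrite /z !hformE xx yy yx.
  have : 0 <= t * (1 - t) * (-1 - hform x y) by rewrite !mulr_ge0 //; lra.
  lra.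
have zx : hform x z < 0.
  rewrite /z !hformE xx.
  have : 0 <= t * (-1 - hform x y) by rewrite mulr_ge0 //; lra.
  lra.
move: z zz zx => z zz zx.
have r0 : 0 < Num.sqrt (- hform z z) by rewrite sqrtr_gt0; lra.
have r2 : Num.sqrt (- hform z z) ^+ 2 = - hform z z by rewrite sqr_sqrtr //; lra.
exists (Num.sqrt (- hform z z))^-1.
  rewrite invr_gt0 r0 invf_le1 //.
  have : 1 ^+ 2 <= Num.sqrt (- hform z z) ^+ 2 by rewrite r2 expr1n; lra.
  by rewrite ler_pXn2r // nnegrE ?ler01 // ltW.
have r1 : 0 < (Num.sqrt (- hform z z))^-1 by rewrite invr_gt0.
apply: (Hn_of_neg xP).
  rewrite hformZl hformZr mulrA -invfM -expr2 r2 invrN mulNr mulVf //.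
  by apply: ltr0_neq0; lra.
by rewrite hformZr pmulr_rlt0.
Qed.

Lemma box_exists x : exists B, box B x.
Proof.
exists (\sum_i `|x i 0|) => i; rewrite (bigD1 i) //= lerDl.
by apply: sumr_ge0.
Qed.

Lemma box_le B B' x : B <= B' -> box B x -> box B' x.
Proof. by move=> BB xB i; apply: le_trans (xB i) BB. Qed.

Lemma segment_box B x y t r : box B x -> box B y -> 0 <= t <= 1 -> 0 < r <= 1 ->
  box B (r *: ((1 - t) *: x + t *: y)).
Proof.
move=> xB yB /andP[t0 t1] /andP[r0 r1] i; rewrite !mxE normrM (gtr0_norm r0).
have zB : `|(1 - t) * x i 0 + t * y i 0| <= B.
  apply: le_trans (ler_normD _ _) _; rewrite !normrM.
  have t1' : 0 <= 1 - t by lra.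
  rewrite (ger0_norm t0) (ger0_norm t1').
  by have := ler_wpM2l t0 (yB i); have := ler_wpM2l t1' (xB i); lra.
apply: le_trans zB; rewrite -[leRHS]mul1r; exact: ler_wpM2r.
Qed.

Lemma crossing_point w x y : Hn x -> Hn y -> hform w x * hform w y <= 0 ->
  exists t r, [/\ 0 <= t <= 1, 0 < r <= 1, Hn (r *: ((1 - t) *: x + t *: y)) &
    hform w (r *: ((1 - t) *: x + t *: y)) = 0].
Proof.
move=> xP yP; set a := hform w x; set b := hform w y => ab.
suff [t t01 tE] : exists2 t, 0 <= t <= 1 & (1 - t) * a + t * b = 0.
  have [r r01 rP] := segment_Hn xP yP t01.
  by exists t, r; split=> //; rewrite !hformE -/a -/b tE mulr0.
have [a0|aN] := eqVneq a 0; first by exists 0; rewrite ?a0 ?lexx ?ler01 //; ring.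
have a2 : 0 < a ^+ 2 by rewrite lt_neqAle sqr_ge0 eq_sym sqrf_eq0 aN.
have d0 : 0 < a ^+ 2 - a * b by lra.
(* This is [a / (a - b)], expanded by [a] so that the denominator is positive. *)
exists (a ^+ 2 / (a ^+ 2 - a * b)).
  by apply/andP; split; [apply: divr_ge0; lra|rewrite ler_pdivrMr // mul1r; lra].
by field; rewrite gt_eqF.
Qed.

(* The null vectors [e_j + e_max] and [e_j - e_max] are not stretched much. *)
Lemma entries_bound g y B i j : (0 < n)%N -> hisom g -> Hn y -> Hn (g *m y) ->
  box B y -> box B (g *m y) -> `|g i j| <= 4 * B ^+ 2.
Proof.
move=> n0 gP yP gyP yB gyB.
pose E l : 'cV[R]_n.+1 := delta_mx l 0.
have B0 : 0 <= B by apply: le_trans (yB ord_max).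
have EE l l' : hform (E l) (E l') = if l == l' then hsgn R l else 0.
  by rewrite hform_delta mxE eqxx andbT eq_sym; case: eqVneq => [->|]; rewrite ?mulr1 ?mulr0.
have sgn1 l : `|hsgn R l| = 1 by rewrite /hsgn; case: ifP; rewrite ?normrN1 ?normr1.
have key l s : l != ord_max -> s = 1 \/ s = -1 ->
    `|g i l + s * g i ord_max| <= 4 * B ^+ 2.
  move=> lm sP; pose xi := E l + s *: E ord_max.
  have xi0 : hform xi xi = 0.
    rewrite /xi !hformE !EE !eqxx (negbTE lm) eq_sym (negbTE lm) /hsgn eqxx (negbTE lm).
    by case: sP => ->; ring.
  have := null_bound i gyP (etrans (hform_isom _ _ gP) xi0).
  rewrite hform_isom // (_ : (g *m xi) i 0 = g i l + s * g i ord_max); last first.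
    by rewrite /xi mulmxDr -scalemxAr -!colE !mxE.
  move=> H; apply: le_trans H _.
  have h1 : `|hform y xi| <= 2 * B.
    rewrite /xi !hformE !hform_delta; apply: le_trans (ler_normD _ _) _.
    rewrite !normrM !sgn1 !mul1r.
    have -> : `|s| = 1 by case: sP => ->; rewrite ?normrN1 ?normr1.
    by have := yB l; have := yB ord_max; lra.
  have h2 : (g *m y) ord_max 0 <= B by apply: le_trans (gyB ord_max); apply: ler_norm.
  have h3 : 0 < (g *m y) ord_max 0 by case: gyP.
  have -> : 4 * B ^+ 2 = (2 * B) * (2 * B) by ring.
  by apply: ler_pM => //; [lra|lra].
(* A spatial index exists because [0 < n]; it serves to bound the last column. *)
have l0 : (ord0 : 'I_n.+1) != ord_max by apply/eqP => /(congr1 val) /= nE; rewrite -nE in n0.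
have half (a b c : R) : `|a + 1 * b| <= c -> `|a + -1 * b| <= c -> `|a| <= c /\ `|b| <= c.
  by rewrite !ler_norml => /andP[? ?] /andP[? ?]; split; apply/andP; split; lra.
have [->|jm] := eqVneq j ord_max.
  by have [] := half _ _ _ (key _ _ l0 (or_introl erefl)) (key _ _ l0 (or_intror erefl)).
by have [] := half _ _ _ (key _ _ jm (or_introl erefl)) (key _ _ jm (or_intror erefl)).
Qed.

End HyperbolicPoints.

(** * Finiteness of bounded parts of a discrete group *)

Section Finiteness.

Lemma finite_of_injective (T : eqType) (K : finType) (f : T -> K) (A : T -> Prop) :
  (forall x y, A x -> A y -> f x = f y -> x = y) -> exists s : seq T, forall x, A x -> x \in s.
Proof.
move=> inj; have /choice[o oP] (a : K) : exists o : option T, forall x, A x -> f x = a -> o = Some x.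
  have [[x [xA xa]]|no] := pselect (exists x, A x /\ f x = a).
    by exists (Some x) => y yA ya; congr Some; apply: inj; rewrite ?xa.
  by exists None => x xA xa; case: no; exists x.
exists (pmap o (enum K)) => x xA; rewrite mem_pmap; apply/mapP; exists (f x).
  by rewrite mem_enum.
by rewrite (oP _ x).
Qed.

(** Pigeonhole on a grid of mesh [d]: if [g] and [g'] share a cell then [invmx g *m g'] is within
    [e] of the identity, and discreteness there gives [g = g']. *)
Lemma bounded_finite (R : realType) n (G : 'M[R]_n.+1 -> Prop) M :
  is_subgroup G -> discrete_set G ->
  exists s : seq 'M[R]_n.+1, forall g, G g -> (forall i j, `|g i j| <= M) ->
    (forall i j, `|invmx g i j| <= M) -> g \in s.
Proof.
move=> [G1 [GM GV]] disc; have [e e0 eP] := disc _ G1.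
pose N : R := n.+1%:R; have N0 : 0 < N by rewrite ltr0n.
(* An entry of [invmx g *m (g' - g)] has [N] terms of size at most [M * d], and [N * M * d < e]. *)
pose d := e / (N * (`|M| + 1)).
have M1 : 0 < `|M| + 1 by have := normr_ge0 M; lra.
have d0 : 0 < d by rewrite divr_gt0 // mulr_gt0.
pose K := Num.truncn (2 * M / d).
pose key (g : 'M[R]_n.+1) : {ffun 'I_n.+1 * 'I_n.+1 -> 'I_K.+1} :=
  [ffun p => inord (Num.truncn ((g p.1 p.2 + M) / d))].
pose A g := [/\ G g, forall i j, `|g i j| <= M & forall i j, `|invmx g i j| <= M].
have [|s sP] := @finite_of_injective _ _ key A; last by exists s => g ? ? ?; apply: sP.
move=> g g' [Gg gM gVM] [Gg' g'M _] keyE.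
have close i j : `|g' i j - g i j| < d.
  have itv (a : R) : `|a| <= M -> [/\ (Num.truncn ((a + M) / d) <= K)%N,
      (Num.truncn ((a + M) / d))%:R <= (a + M) / d &
      (a + M) / d < (Num.truncn ((a + M) / d))%:R + 1].
    rewrite ler_norml => /andP[a1 a2].
    have a0 : 0 <= (a + M) / d by rewrite divr_ge0 ?(ltW d0) //; lra.
    have /andP[? ?] := truncn_itv a0; split=> //; last by rewrite natr1.
    apply: le_truncn.
    by rewrite ler_pM2r ?invr_gt0 //; lra.
  have [k1 l1 u1] := itv _ (gM i j); have [k2 l2 u2] := itv _ (g'M i j).
  have /ffunP/(_ (i, j)) := keyE; rewrite !ffunE /= => /(congr1 val).
  rewrite /= !inordK ?ltnS // => tE; rewrite tE in l1 u1.
  have e1 : (g' i j - g i j) / d = (g' i j + M) / d - (g i j + M) / d by ring.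
  have : `|(g' i j - g i j) / d| < 1 by rewrite e1 ltr_norml; apply/andP; split; lra.
  by rewrite normrM normfV (gtr0_norm d0) ltr_pdivrMr // mul1r.
have [gu GgV] := GV _ Gg.
suff E : invmx g *m g' = 1%:M by rewrite -[g']mul1mx -(mulmxV gu) -mulmxA E mulmx1.
apply: eP => [|i j]; first exact: GM.
have -> : (invmx g *m g') i j - 1%:M i j = \sum_l invmx g i l * (g' l j - g l j).
  by rewrite -(mulVmx gu) !mxE -sumrB; apply: eq_bigr => l _; rewrite mulrBr.
have MM : 0 <= M by apply: le_trans (gM i j).
apply: le_lt_trans (ler_norm_sum _ _ _) _.
apply: (@le_lt_trans _ _ (\sum_(l < n.+1) M * d)).
  by apply: ler_sum => l _; rewrite normrM ler_pM // ltW.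
rewrite sumr_const card_ord -mulr_natl -/N /d (ger0_norm MM).
have -> : N * (M * (e / (N * (M + 1)))) = e * (M / (M + 1)).
  by field; rewrite !gt_eqF //; lra.
by rewrite gtr_pMr // ltr_pdivrMr; lra.
Qed.

End Finiteness.

Lemma seq_argmin (R : realType) (T : eqType) (f : T -> R) (s : seq T) a : a \in s ->
  exists2 b, b \in s & forall c, c \in s -> f b <= f c.
Proof.
elim: s a => // x s IH a _; case: s IH => [|y s] IH.
  by exists x; rewrite ?mem_head // => c; rewrite inE => /eqP->.
have [b bs bP] := IH y (mem_head _ _).
have [xb|bx] := leP (f x) (f b).
  exists x; first exact: mem_head.
  by move=> c; rewrite inE => /orP[/eqP->//|/bP]; apply: le_trans.
exists b; first by rewrite inE bs orbT.
by move=> c; rewrite inE => /orP[/eqP->|/bP//]; apply: ltW.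
Qed.

(** * Linearity and size of the contraction [ev] *)

Section TensorLinearity.
Variables (R : realType) (n k : nat).
Implicit Types (xi : 'cV[R]_n.+1) (g : 'M[R]_n.+1) (T : tensor R n k).

Lemma evD T T' xi : ev (fun I => T I + T' I) xi = ev T xi + ev T' xi.
Proof. by rewrite /ev -big_split; apply: eq_bigr => I _; rewrite mulrDr. Qed.

Lemma evB T T' xi : ev (fun I => T I - T' I) xi = ev T xi - ev T' xi.
Proof. by rewrite /ev -sumrB; apply: eq_bigr => I _; rewrite mulrBr. Qed.

Lemma ev_sum (A : Type) (s : seq A) (c : A -> R) (T : A -> tensor R n k) xi :
  ev (fun I => \sum_(a <- s) c a * T a I) xi = \sum_(a <- s) c a * ev (T a) xi.
Proof.
rewrite /ev; under eq_bigr do rewrite mulr_sumr.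
rewrite exchange_big; apply: eq_bigr => a _; rewrite mulr_sumr.
by apply: eq_bigr => I _; rewrite mulrCA.
Qed.

Lemma tact_sum (A : Type) (s : seq A) (c : A -> R) (T : A -> tensor R n k) g I :
  tact g (fun I => \sum_(a <- s) c a * T a I) I = \sum_(a <- s) c a * tact g (T a) I.
Proof.
rewrite /tact; under eq_bigr do rewrite mulr_sumr.
rewrite exchange_big; apply: eq_bigr => a _; rewrite mulr_sumr.
by apply: eq_bigr => J _; rewrite mulrCA.
Qed.

Lemma S0_sum (A : Type) (s : seq A) (c : A -> R) (T : A -> tensor R n k) :
  (forall a, S0 (T a)) -> S0 (fun I => \sum_(a <- s) c a * T a I).
Proof.
move=> TS; split=> [t I|k2 I].
  by apply: eq_bigr => a _; have [-> _] := TS a.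
under eq_bigr do rewrite mulr_sumr.
rewrite exchange_big big1 //= => a _; have [_ /(_ k2 I) E] := TS a.
transitivity (c a * \sum_b hsgn R b * T a (upd2 I b)); last by rewrite E mulr0.
by rewrite mulr_sumr; apply: eq_bigr => b _; rewrite mulrCA.
Qed.

Lemma evZ T s xi : ev T (s *: xi) = s ^+ k * ev T xi.
Proof.
rewrite /ev mulr_sumr; apply: eq_bigr => I _; rewrite mulrA; congr (_ * _).
rewrite -[in s ^+ k](card_ord k) -prodr_const -big_split; apply: eq_bigr => l _ /=.
by rewrite !mxE mulrCA.
Qed.

Lemma ev_le T xi M : (forall i, `|xi i 0| <= M) -> `|ev T xi| <= (\sum_I `|T I|) * M ^+ k.
Proof.
move=> xiM; apply: le_trans (ler_norm_sum _ _ _) _; rewrite mulr_suml.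
apply: ler_sum => I _; rewrite normrM mulrC ler_wpM2l // normr_prod.
rewrite -[in M ^+ k](card_ord k) -prodr_const; apply: ler_prod => l _.
rewrite normr_ge0 /= mxE normrM /hsgn.
by case: ifP => _; rewrite ?normrN1 ?normr1 mul1r.
Qed.

End TensorLinearity.

(** * Lifts of the hypersurface: disjointness, local finiteness, neighbours *)

Section Walls.
Variables (R : realType) (n k : nat) (G : 'M[R]_n.+1 -> Prop) (v : 'cV[R]_n.+1).
Hypotheses (n2 : (2 <= n)%N) (Gsub : is_subgroup G) (GSO : forall g, G g -> in_SOo g)
  (Gdisc : discrete_set G) (Gcoc : cocompact G) (vv : hform v v = 1)
  (emb : forall g, G g -> stab_plane v g \/ (forall x, hplane v x -> ~ hplane v (g *m x)))
  (cpt : exists B, forall x, hplane v x -> exists2 g, G g /\ stab_plane v g & box B (g *m x))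
  (ori : forall g, G g -> stab_plane v g -> g *m v = v).
Implicit Types (x y z w xi : 'cV[R]_n.+1) (g h : 'M[R]_n.+1).

Let G1 : G 1%:M. Proof. by case: Gsub. Qed.
Let GM g h : G g -> G h -> G (g *m h). Proof. by case: Gsub => _ [+ _]; apply. Qed.
Let Gu g : G g -> g \in unitmx. Proof. by case: Gsub => _ [_ +] Gg => /(_ g Gg)[]. Qed.
Let GV g : G g -> G (invmx g). Proof. by case: Gsub => _ [_ +] Gg => /(_ g Gg)[]. Qed.
Let Giso g : G g -> hisom g. Proof. by move/GSO => [[_ ?] _]. Qed.
Let GHn g x : G g -> Hn x -> Hn (g *m x). Proof. by move/GSO => [_]; apply. Qed.

Let hformG g x y : G g -> hform (g *m x) (g *m y) = hform x y.
Proof. by move/Giso/hform_isom; apply. Qed.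

Let hformV g x y : G g -> hform x (g *m y) = hform (invmx g *m x) y.
Proof. by move=> Gg; rewrite -(hformG (invmx g *m x) y Gg) mulKVmx ?Gu. Qed.

Let hformVl g x y : G g -> hform (g *m x) y = hform x (invmx g *m y).
Proof. by move=> Gg; rewrite hformC hformV // hformC. Qed.

(* The lifts of the hypersurface are the hyperplanes [hplane w] with [wall w]. *)
Definition wall w := exists2 g, G g & w = g *m v.

Lemma wall_self : wall v.
Proof. by exists 1%:M; rewrite ?mul1mx. Qed.

Lemma wall_act g w : G g -> wall w -> wall (g *m w).
Proof. by move=> Gg [h Gh ->]; exists (g *m h); rewrite ?mulmxA //; apply: GM. Qed.

Lemma wall_unit w : wall w -> hform w w = 1.
Proof. by case=> g Gg ->; rewrite hformG. Qed.

(** Embeddedness makes lifts that meet coincide as hyperplanes; orientability then makes their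
    normals equal and not merely opposite. *)
Lemma wall_disjoint w w' x : wall w -> wall w' -> hplane w x -> hform w' x = 0 -> w' = w.
Proof.
move=> [g Gg ->] [h Gh ->] [xP wx w'x].
have Gk : G (invmx g *m h) by apply: GM => //; apply: GV.
have [st|dis] := emb Gk.
  by have := ori Gk st; rewrite -mulmxA => E; rewrite -[LHS](mulKVmx (Gu Gg)) E.
have Vh : G (invmx h) by apply: GV.
case: (dis (invmx h *m x)); first by split; [exact: GHn|rewrite -hformVl].
rewrite -mulmxA mulKVmx ?Gu //; split; first by apply: GHn => //; apply: GV.
by rewrite -hformVl.
Qed.

Lemma wall_neqN w w' x : wall w -> wall w' -> hplane w x -> w' != w -> w' != - w.
Proof.
move=> wW wW' wx; apply: contra => /eqP E; apply/eqP; apply: (wall_disjoint wW wW' wx).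
by case: wx => _ wx; rewrite E hformNl wx oppr0.
Qed.

(** If [g *m v] is normal to a lift through [z], the stabiliser of the hyperplane of [v] moves
    [invmx g *m z] to a bounded point [y] and fixes [v]. So [d] defines the same lift and sends [y]
    to [z], both bounded; finitely many [d] do so. *)
Lemma walls_meeting_box B : exists s : seq 'cV[R]_n.+1, forall w, wall w ->
  (exists z, [/\ Hn z, box B z & hform w z = 0]) -> w \in s.
Proof.
have [B1 B1P] := cpt; pose B2 := Num.max B B1.
have [s0 s0P] := bounded_finite (4 * B2 ^+ 2) Gsub Gdisc.
exists [seq g *m v | g <- s0] => w [g Gg ->] [z [zP zB wz]].
have [h [Gh hst] hB] := B1P (invmx g *m z) (conj (GHn (GV Gg) zP) (etrans (esym (hformVl _ _ Gg)) wz)).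
have hv := ori Gh hst.
set y := h *m _ in hB.
have yP : Hn y by apply: GHn => //; apply: GHn => //; apply: GV.
pose d := g *m invmx h.
have Gd : G d by apply: GM => //; apply: GV.
have dy : d *m y = z by rewrite /d /y -mulmxA mulKmx ?Gu // mulKVmx ?Gu.
have dz : invmx d *m z = y by rewrite -dy mulKmx ?Gu.
have zB2 : box B2 z by apply: box_le zB; rewrite le_max lexx.
have yB2 : box B2 y by apply: box_le hB; rewrite le_max lexx orbT.
apply/mapP; exists d; last by rewrite /d -mulmxA -{2}hv mulKmx ?Gu.
have n0 : (0 < n)%N by apply: ltn_trans n2.
apply: s0P => // i j.
  by apply: (entries_bound _ _ n0 (Giso Gd) yP); rewrite ?dy.
by apply: (entries_bound _ _ n0 (Giso (GV Gd)) zP); rewrite ?dz.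
Qed.

(** Such a lift meets the segment from [x] to [y], which stays in a box independent of [y]. *)
Lemma walls_crossing x B : Hn x -> exists s : seq 'cV[R]_n.+1,
  forall w y, wall w -> Hn y -> box B y -> hform w x * hform w y <= 0 -> w \in s.
Proof.
move=> xP; have [B0 xB] := box_exists x; pose B' := Num.max B B0.
have [s sP] := walls_meeting_box B'; exists s => w y wW yP yB xy.
have [t [r [t01 r01 zP wz]]] := crossing_point xP yP xy.
apply: sP => //; eexists; split; [exact: zP| |exact: wz].
by apply: segment_box => //; [apply: box_le xB|apply: box_le yB]; rewrite le_max lexx ?orbT.
Qed.

(** Otherwise [w'] would meet the segment from [x] to [y], which lies in the hyperplane of [w]. *)
Lemma wall_same_side w w' x y : wall w -> wall w' -> w' != w -> hplane w x -> hplane w y ->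
  0 < hform w' x * hform w' y.
Proof.
move=> wW wW' ne [xP wx] [yP wy]; rewrite ltNge; apply: contra ne => le0.
have [t [r [_ _ zP wz]]] := crossing_point xP yP le0.
apply/eqP; apply: wall_disjoint wW wW' _ wz; split=> //.
by rewrite !hformE wx wy; ring.
Qed.

(* Points far away on the [e]-side of [w] are within bounded distance of a lift. *)
Lemma far_wall e w x : e = 1 \/ e = -1 -> hform w w = 1 -> hplane w x ->
  exists w' y, [/\ wall w', hplane w' y & 0 < e * hform w y].
Proof.
move=> eP ww [xP wx]; have [xx _] := xP; have xw : hform x w = 0 by rewrite hformC.
have e2 : e * e = 1 by case: eP => ->; ring.
have [B BP] := Gcoc; have [p [pP vp]] := hplane_inhabited vv.
(* [K] bounds the product of [p] with any vector of the box; [z] below is taken at height [e * r]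
   over [w] with [r > K]. *)
pose K := \sum_i `|p i 0| * B; pose r := `|K| + 1.
have r0 : 0 < r by rewrite /r; have := normr_ge0 K; lra.
have c2 : Num.sqrt (1 + r ^+ 2) ^+ 2 = 1 + r ^+ 2 by rewrite sqr_sqrtr //; have := sqr_ge0 r; lra.
have : 0 <= Num.sqrt (1 + r ^+ 2) by apply: sqrtr_ge0.
set c := Num.sqrt _ in c2 * => c0.
have rc : r <= c by rewrite -(@ler_pXn2r _ 2) ?nnegrE ?(ltW r0) // c2; lra.
have cK : K < c by apply: lt_le_trans rc; have := ler_norm K; rewrite /r; lra.
pose z := c *: x + (e * r) *: w.
have zP : Hn z.
  apply: (Hn_of_neg xP); rewrite /z !hformE ?wx ?xw xx ?ww.
    by rewrite [LHS](_ : _ = - c ^+ 2 + (e * e) * r ^+ 2); [rewrite e2 c2; ring|ring].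
  lra.
have [g Gg gB] := BP _ zP; have Vg := GV Gg.
exists (invmx g *m v), (invmx g *m p); split.
- by apply: wall_act => //; apply: wall_self.
- by split; [exact: GHn|rewrite hformG].
have yP : Hn (invmx g *m p) by apply: GHn.
have := Hn_hform_le yP xP.
have : - K <= hform (invmx g *m p) z.
  rewrite -hformV // lerNl; apply: le_trans (ler_norm _) _; rewrite normrN.
  apply: le_trans (ler_norm_sum _ _ _) _; apply: ler_sum => i _; rewrite !normrM.
  have -> : `|hsgn R i| = 1 by rewrite /hsgn; case: ifP; rewrite ?normrN1 ?normr1.
  by rewrite mul1r ler_wpM2l //; apply: gB.
rewrite /z !hformE (hformC _ w); set be := hform w _; set a := hform _ x => h1 h2.
(* If [y] were not on the [e]-side, its product with [z] would be at most [- c], hence below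
   [- K]. *)
rewrite ltNge; apply/negP => h3.
have h4 : c * (a + 1) <= 0 by rewrite mulr_ge0_le0 //; lra.
have h5 : r * (e * be) <= 0 by rewrite mulr_ge0_le0 // ltW.
have : e * r * be = r * (e * be) by ring.
lra.
Qed.

(* The first lift met on the way from [x] to a far point on the [e]-side of [w] *)
Lemma next_wall e w x : e = 1 \/ e = -1 -> wall w -> hplane w x ->
  exists w' y, [/\ wall w', w' != w, hplane w' y, 0 < e * hform w y &
    forall w'', wall w'' -> w'' != w -> w'' != w' -> 0 < hform w'' x * hform w'' y].
Proof.
move=> eP wW wx; have [xP wx0] := wx.
have [w0 [y0 [wW0 [y0P wy0] y0e]]] := far_wall eP (wall_unit wW) wx.
have w0N : w0 != w.
  by apply/eqP => E; move: y0e; rewrite -E wy0 mulr0 ltxx.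
have [B y0B] := box_exists y0; have [s sP] := walls_crossing B xP.
pose P w'' := `[< [/\ wall w'', w'' != w & hform w'' x * hform w'' y0 <= 0] >].
(* For a lift weakly separating [x] from [y0], [t w''] is the parameter where it meets the chord
   from [x] to [y0]; [w'] minimises it. *)
pose q w'' := hform w'' x ^+ 2 - hform w'' x * hform w'' y0.
pose t w'' := hform w'' x ^+ 2 / q w''.
have w0s : w0 \in [seq w'' <- s | P w''].
  rewrite mem_filter; apply/andP; split; first by apply/asboolP; rewrite wy0 mulr0 lexx.
  by apply: sP y0P y0B _; rewrite // wy0 mulr0.
have [w' + tmin] := seq_argmin t w0s.
rewrite mem_filter => /andP[/asboolP[wW' w'N w'le] _].
have x2 w'' : wall w'' -> w'' != w -> 0 < hform w'' x ^+ 2.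
  move=> W ne; rewrite lt_neqAle sqr_ge0 andbT eq_sym sqrf_eq0.
  by apply: contra ne => /eqP h0; rewrite (wall_disjoint wW W wx h0).
have q0 : 0 < q w' by rewrite /q; have := x2 _ wW' w'N; lra.
have tE : t w' * q w' = hform w' x ^+ 2 by rewrite /t divfK ?gt_eqF.
have t0 : 0 < t w' by rewrite divr_gt0 ?x2.
have t1 : t w' <= 1 by rewrite ler_pdivrMr // mul1r /q; lra.
have t01 : 0 <= t w' <= 1 by rewrite ltW.
have [r /andP[r0 _] yP] := segment_Hn xP y0P t01.
set y := r *: _ in yP.
have hy w'' : hform w'' y = r * ((1 - t w') * hform w'' x + t w' * hform w'' y0).
  by rewrite /y !hformE.
have w'y : hform w' y = 0.
  have xN : hform w' x != 0 by rewrite -sqrf_eq0 gt_eqF ?x2.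
  rewrite hy; apply: (mulfI xN); move: tE; rewrite /q => tE.
  rewrite [LHS](_ : _ = r * (hform w' x ^+ 2 - t w' * (hform w' x ^+ 2 - hform w' x * hform w' y0))).
    by rewrite tE; ring.
  ring.
exists w', y; split=> //.
  by rewrite hy wx0 mulr0 add0r mulrCA pmulr_rgt0 // mulrCA pmulr_rgt0.
move=> w'' W'' ne ne'; rewrite hy.
rewrite [X in _ < X](_ : _ =
    r * ((1 - t w') * hform w'' x ^+ 2 + t w' * (hform w'' x * hform w'' y0))); last by ring.
rewrite pmulr_rgt0 //.
have xx := x2 _ W'' ne.
have h1 : 0 <= (1 - t w') * hform w'' x ^+ 2 by apply: mulr_ge0; [lra|exact: ltW].
have [cr|ncr] := leP (hform w'' x * hform w'' y0) 0; last first.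
  by apply: ltr_wpDl => //; rewrite pmulr_rgt0.
have q0' : 0 < q w'' by rewrite /q; lra.
have tt : t w' <= t w''.
  apply: tmin; rewrite mem_filter; apply/andP; split; first exact/asboolP.
  exact: sP y0P y0B _.
have tq : t w' * q w'' <= hform w'' x ^+ 2 by rewrite -ler_pdivlMr.
(* Equality would put [y] on [w''] as well as on [w'], and lifts are disjoint. *)
rewrite lt_neqAle; apply/andP; split; last by rewrite /q in tq; lra.
apply: contra ne' => /eqP E; apply/eqP; apply: wall_disjoint wW' W'' (conj yP w'y) _.
have xN : hform w'' x != 0 by rewrite -sqrf_eq0 gt_eqF.
apply: (mulfI xN); rewrite mulr0 hy.
rewrite [LHS](_ : _ =
    r * ((1 - t w') * hform w'' x ^+ 2 + t w' * (hform w'' x * hform w'' y0))); last by ring.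
by rewrite -E mulr0.
Qed.

(** Points on a lift count with its negative side. Being a difference of values at [y] and [x], the
    jump telescopes without any general position. *)
Definition jump x y w : R := (0 < hform w y)%R%:R - (0 < hform w x)%R%:R.

Lemma jump_eq0 x y w : 0 < hform w x * hform w y -> jump x y w = 0.
Proof.
rewrite /jump => xy; suff -> : (0 < hform w x) = (0 < hform w y) by rewrite subrr.
have [x0|x0|x0] := ltgtP 0 (hform w x); last by rewrite -x0 mul0r ltxx in xy.
  by rewrite pmulr_rgt0 // in xy; rewrite xy.
by rewrite nmulr_rgt0 // in xy; rewrite ltNge (ltW xy).
Qed.

Lemma jump_le1 x y w : `|jump x y w| <= 1.
Proof. by rewrite /jump; do 2 case: (_ < _); rewrite /= ?subrr ?subr0 ?sub0r ?normrN1 ?normr1 ?normr0. Qed.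

Definition separators x y (s : seq 'cV[R]_n.+1) :=
  [/\ uniq s, forall w, w \in s -> wall w & forall w, wall w -> jump x y w != 0 -> w \in s].

Lemma separators_box x B : Hn x -> exists s, forall y, Hn y -> box B y -> separators x y s.
Proof.
move=> xP; have [s sP] := walls_crossing B xP.
exists (undup [seq w <- s | `[< wall w >]]) => y yP yB; split; first exact: undup_uniq.
  by move=> w; rewrite mem_undup mem_filter => /andP[/asboolP].
move=> w wW j0; rewrite mem_undup mem_filter asboolT //=; apply: sP yB _ => //.
by rewrite leNgt; apply: contra j0 => /jump_eq0 ->.
Qed.

Lemma sum_separators x y s s' (phi : 'cV[R]_n.+1 -> R) : separators x y s -> separators x y s' ->
  \sum_(w <- s) jump x y w * phi w = \sum_(w <- s') jump x y w * phi w.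
Proof.
move=> [us sW sP] [us' sW' sP'].
have red (r : seq 'cV[R]_n.+1) : \sum_(w <- r) jump x y w * phi w =
    \sum_(w <- [seq w <- r | jump x y w != 0]) jump x y w * phi w.
  rewrite big_filter [LHS](bigID (fun w => jump x y w == 0)) /= big1 ?add0r //.
  by move=> w /eqP->; rewrite mul0r.
rewrite red [RHS]red; apply: perm_big; apply: uniq_perm; rewrite ?filter_uniq //.
move=> w; rewrite !mem_filter; have [//|j0 /=] := eqVneq (jump x y w) 0.
by apply/idP/idP => [/sW|/sW'] W; [apply: sP'|apply: sP].
Qed.

Lemma sepfun_exists : exists F : 'cV[R]_n.+1 -> 'cV[R]_n.+1 -> seq 'cV[R]_n.+1,
  forall x y, Hn x -> Hn y -> separators x y (F x y).
Proof.
have /choice[F FP] (p : 'cV[R]_n.+1 * 'cV[R]_n.+1) :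
    exists s, Hn p.1 -> Hn p.2 -> separators p.1 p.2 s.
  have [p1|no] := pselect (Hn p.1); last by exists [::].
  have [B pB] := box_exists p.2; have [s sP] := separators_box B p1.
  by exists s => _ p2; apply: sP.
by exists (fun x y => F (x, y)) => x y; apply: (FP (x, y)).
Qed.

(** * The crossing cocycle *)

Variable T : 'cV[R]_n.+1 -> tensor R n k.
Hypotheses (k1 : (1 <= k)%N) (TS : forall w, S0 (T w))
  (evT : forall w xi, hform xi xi = 0 -> ev (T w) xi = hform xi w ^+ k)
  (TG : forall g w, hisom g -> T (g *m w) = tact g (T w)).
Variables (F : 'cV[R]_n.+1 -> 'cV[R]_n.+1 -> seq 'cV[R]_n.+1) (x0 : 'cV[R]_n.+1).
Hypotheses (FP : forall x y, Hn x -> Hn y -> separators x y (F x y)) (x0P : Hn x0).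

Definition crossing x y : tensor R n k := fun I => \sum_(w <- F x y) jump x y w * T w I.

Lemma crossingE x y s : Hn x -> Hn y -> separators x y s ->
  crossing x y = (fun I => \sum_(w <- s) jump x y w * T w I).
Proof. by move=> xP yP sP; apply: funext => I; apply: sum_separators => //; apply: FP. Qed.

(** Over a common list of lifts the jumps telescope. *)
Lemma crossingD x y z : Hn x -> Hn y -> Hn z ->
  crossing x z = (fun I => crossing x y I + crossing y z I).
Proof.
move=> xP yP zP; pose s := undup (F x y ++ F y z ++ F x z).
have [[_ W1 J1] [_ W2 J2] [_ W3 J3]] := And3 (FP xP yP) (FP yP zP) (FP xP zP).
have us : uniq s by apply: undup_uniq.
have sW w : w \in s -> wall w.
  by rewrite mem_undup !mem_cat => /or3P[/W1|/W2|/W3].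
have good a b : (forall w, wall w -> jump a b w != 0 -> w \in s) -> separators a b s by [].
rewrite (@crossingE x z s) // 1?(@crossingE x y s) // 1?(@crossingE y z s) //; last first.
- by apply: good => w wW /J3 -/(_ wW); rewrite mem_undup !mem_cat => ->; rewrite !orbT.
- by apply: good => w wW /J1 -/(_ wW); rewrite mem_undup !mem_cat => ->.
- by apply: good => w wW /J2 -/(_ wW); rewrite mem_undup !mem_cat => ->; rewrite orbT.
apply: funext => I; rewrite -big_split; apply: eq_bigr => w _ /=.
by rewrite -mulrDl /jump; congr (_ * _); ring.
Qed.

Lemma crossing_act g x y : G g -> Hn x -> Hn y ->
  crossing (g *m x) (g *m y) = tact g (crossing x y).
Proof.
move=> Gg xP yP; have [us sW sJ] := FP xP yP.
have inj : injective (mulmx g : 'cV[R]_n.+1 -> _) by apply: can_inj (mulKmx (Gu Gg)).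
have jumpG w : jump (g *m x) (g *m y) (g *m w) = jump x y w by rewrite /jump !hformG.
rewrite (@crossingE _ _ [seq g *m w | w <- F x y]); [|exact: GHn|exact: GHn|].
  apply: funext => I; rewrite /crossing tact_sum big_map; apply: eq_bigr => w _.
  by rewrite jumpG TG //; apply: Giso.
split; first by rewrite map_inj_uniq.
  by move=> _ /mapP[w /sW wW ->]; apply: wall_act.
move=> w wW j0; apply/mapP; exists (invmx g *m w); last by rewrite mulKVmx ?Gu.
apply: sJ; first by apply: wall_act => //; apply: GV.
by rewrite -jumpG mulKVmx ?Gu.
Qed.

Lemma crossing_S0 x y : S0 (crossing x y).
Proof. exact: S0_sum. Qed.

Lemma ev_crossing x y xi s : Hn x -> Hn y -> separators x y s -> hform xi xi = 0 ->
  ev (crossing x y) xi = \sum_(w <- s) jump x y w * hform xi w ^+ k.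
Proof.
move=> xP yP sP xi0; rewrite (crossingE xP yP sP) ev_sum.
by apply: eq_bigr => w _; rewrite evT.
Qed.

(** * Contradiction from a primitive [T0] of the cocycle *)

Section Coboundary.
Variable T0 : tensor R n k.
Hypothesis T0P : forall g, G g -> crossing x0 (g *m x0) = (fun I => tact g T0 I - T0 I).

(* Equivariant and locally constant off the walls, with jump [T w] across the wall [w] *)
Definition dev x : tensor R n k := fun I => T0 I + crossing x0 x I.

Lemma dev_crossing x y xi : Hn x -> Hn y -> ev (dev y) xi = ev (dev x) xi + ev (crossing x y) xi.
Proof. by move=> xP yP; rewrite /dev !evD (crossingD x0P xP yP) evD addrA. Qed.

(** Passing through [g *m x0], the coboundary equation turns [T0] plus the first crossing into
    [tact g T0]; the second crossing is the translate of [crossing x0 x]. *)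
Lemma ev_dev_act g x xi : G g -> Hn x -> ev (dev (g *m x)) (g *m xi) = ev (dev x) xi.
Proof.
move=> Gg xP; have gx0 := GHn Gg x0P; have gx := GHn Gg xP; have gI := Giso Gg.
rewrite /dev !evD (crossingD x0P gx0 gx) evD T0P // evB crossing_act // !ev_tact //; ring.
Qed.

(** By equivariance and cocompactness [x] may be taken in a box, where finitely many tensors occur;
    [null_bound] then replaces the coordinates of [xi] by [hform x xi]. *)
Lemma dev_bound : exists2 C, 0 <= C & forall x xi, Hn x -> hform xi xi = 0 ->
  `|ev (dev x) xi| <= C * `|hform x xi| ^+ k.
Proof.
have [B BP] := Gcoc; have [s sP] := separators_box B x0P.
pose C := \sum_I `|T0 I| + \sum_(w <- s) \sum_I `|T w I|.
have C0 : 0 <= C by rewrite addr_ge0 ?sumr_ge0 // => w _; apply: sumr_ge0.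
have near y xi : Hn y -> box B y -> hform xi xi = 0 ->
    `|ev (dev y) xi| <= C * (2 * `|B| * `|hform y xi|) ^+ k.
  move=> yP yB xi0; set M := 2 * _ * _.
  have xiM i : `|xi i 0| <= M.
    apply: le_trans (null_bound i yP xi0) _; rewrite ler_wpM2r // ler_wpM2l //.
    apply: le_trans (ler_norm _) _; apply: le_trans (yB _) _; apply: ler_norm.
  have M0 : 0 <= M by rewrite !mulr_ge0.
  rewrite /dev evD (crossingE x0P yP (sP y yP yB)) ev_sum.
  apply: le_trans (ler_normD _ _) _; rewrite /C mulrDl; apply: lerD; first exact: ev_le.
  apply: le_trans (ler_norm_sum _ _ _) _; rewrite mulr_suml; apply: ler_sum => w _.
  rewrite normrM -[leRHS]mul1r; apply: ler_pM => //; [exact: jump_le1|exact: ev_le].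
exists (C * (2 * `|B|) ^+ k); first by rewrite mulr_ge0 // exprn_ge0 // mulr_ge0.
move=> x xi xP xi0; have [g Gg gB] := BP x xP.
rewrite -(ev_dev_act xi Gg xP) -(hformG x xi Gg) -mulrA -exprMn.
by apply: near => //; [exact: GHn|rewrite hformG].
Qed.

(** No other lift separates two points of [w], and [w] itself has zero jump between them. *)
Lemma dev_wall w x y xi : wall w -> hplane w x -> hplane w y -> ev (dev y) xi = ev (dev x) xi.
Proof.
move=> wW wx wy; have [xP wx0] := wx; have [yP wy0] := wy.
rewrite (@dev_crossing x) // (@crossingE x y [::]) //.
  by rewrite ev_sum big_nil addr0.
split=> // w' wW'; have [->|ne] := eqVneq w' w; first by rewrite /jump wx0 wy0 subrr eqxx.
by rewrite jump_eq0 ?eqxx //; apply: wall_same_side wx wy.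
Qed.

(* Let the point of the wall tend to [xi] in the bound [dev_bound]. *)
Lemma dev_ideal w y xi : wall w -> hplane w y -> hform xi xi = 0 -> xi != 0 -> hform w xi = 0 ->
  ev (dev y) xi = 0.
Proof.
move=> wW wy xi0 xiN wxi; have [yP wy0] := wy; have [yy _] := yP.
have [C C0 CP] := dev_bound.
have mN := null_Hn_neq0 yP xi0 xiN; set m := hform y xi in mN.
(* The unit tangent at [y] towards [xi]: indeed [xi = (- m) *: (y + e)], and along the geodesic the
   product with [xi] decays like [m * s]. *)
pose e := (- m^-1) *: xi - y.
have xiy : hform xi y = m by rewrite hformC.
have ee : hform e e = 1 by rewrite /e !hformE xi0 yy xiy -/m; field.
have ye : hform y e = 0 by rewrite /e !hformE yy -/m; field.
have we : hform w e = 0 by rewrite /e !hformE wxi wy0; ring.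
apply: (@le_linear_eq0 _ _ (C * `|m| ^+ k)) => s /andP[s0 s1].
have si : 0 < s^-1 by rewrite invr_gt0.
have gP : Hn (geo y e s^-1) by apply: geo_Hn.
rewrite -(@dev_wall w _ (geo y e s^-1)) //; last by split; [|exact: geo_orth].
apply: le_trans (CP _ _ gP xi0) _.
have -> : hform (geo y e s^-1) xi = m * s.
  rewrite /geo /e !hformE xi0 -/m invrK; field; by rewrite mN gt_eqF.
rewrite normrM exprMn mulrA ler_wpM2l ?mulr_ge0 ?exprn_ge0 //.
rewrite (gtr0_norm s0) -(prednK k1) exprS -[leRHS]mulr1 ler_wpM2l ?(ltW s0) //.
by rewrite exprn_ile1 // ltW.
Qed.

(* Along a geodesic of the wall the values at [d *: w + y] are, after rescaling, those of a
   polynomial which grows like a monomial. *)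
Lemma dev_const w x y d : wall w -> hplane w x -> hplane w y -> d = 1 \/ d = -1 ->
  ev (dev x) (d *: w + y) = d ^+ k * ev (dev x) (w + x).
Proof.
move=> wW wx wy dP; have ww := wall_unit wW; have [xP wx0] := wx.
have [C C0 CP] := dev_bound.
have [e [s [ee we xe s0 yE]]] := geo_connect n2 ww wx wy.
(* The curve is [t *: (w + geo x e t)]; at [- t] it is a multiple of [w - geo x e t], so one
   polynomial covers both signs of [d]. *)
have [P PE] := ev_poly (dev x) (2^-1 *: (x - e)) w (2^-1 *: (x + e)).
have PE' d' t : t != 0 -> d' * d' = 1 -> P.[d' * t] = (d' * t) ^+ k * ev (dev x) (w + d' *: geo x e t).
  move=> tN d2; rewrite PE -evZ; congr (ev _ _); rewrite /geo; apply/matrixP => i j; rewrite !mxE.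
  rewrite [RHS](_ : _ = d' * t * w i j + d' * d' * (2^-1 * (x i j - e i j)) +
    d' * d' * t ^+ 2 * (2^-1 * (x i j + e i j))); last by field.
  by rewrite exprMn [d' ^+ 2]expr2 d2; ring.
have PX : P = P`_k *: 'X^k.
  apply: (@monomial_of_bound _ _ _ C) => t t0.
  have gP : Hn (geo x e t) by apply: geo_Hn.
  have [gg _] := gP; have wg : hform w (geo x e t) = 0 by apply: geo_orth.
  have tN : t != 0 by rewrite gt_eqF.
  have := PE' 1 t tN (mul1r 1); rewrite scale1r mul1r => ->.
  rewrite -(@dev_wall w _ (geo x e t)) // normrM mulrC normrX (gtr0_norm t0).
  rewrite ler_wpM2r ?exprn_ge0 ?(ltW t0) //.
  have gw : hform (geo x e t) w = 0 by rewrite hformC.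
  apply: le_trans (CP _ _ gP _) _; first by rewrite (hformDl w) !(hformDr w) ww gg wg gw; ring.
  by rewrite (hformDr w) gg gw add0r normrN1 expr1n mulr1.
have d2 : d * d = 1 by case: dP => ->; ring.
have val d' t : t != 0 -> d' * d' = 1 -> ev (dev x) (w + d' *: geo x e t) = P`_k.
  move=> tN d'2; have d'N : d' != 0 by apply/eqP => d0; move: d'2; rewrite d0 mul0r; lra.
  have := PE' d' t tN d'2; rewrite {1}PX hornerZ hornerXn mulrC => /mulfI -> //.
  by rewrite expf_neq0 // mulf_neq0.
have sN : s != 0 by rewrite gt_eqF.
have -> : d *: w + y = d *: (w + d *: geo x e s) by rewrite scalerDr scalerA d2 scale1r yE.
rewrite evZ val // -(val 1 1) ?oner_neq0 ?mul1r // scale1r; congr (_ * ev _ (_ + _)).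
by apply/matrixP => i j; rewrite !mxE; field.
Qed.

(* [xi = d *: w + z] lies at infinity of the next wall [w'], where [dev] vanishes. *)
Lemma dev_side (e : R) w x : e = 1 \/ e = -1 -> wall w -> hplane w x ->
  ev (dev x) (w + x) = - (0 < e)%R%:R :> R.
Proof.
move=> eP wW wx; have ww := wall_unit wW; have [xP wx0] := wx.
have [w' [y [wW' ne w'y ey sep]]] := next_wall eP wW wx.
have [yP wy0] := w'y.
have [d [z [dP wz w'xi]]] := ideal_point n2 wx ww (wall_unit wW') ne (wall_neqN wW wW' wx ne).
have [[zz _] wz0] := wz; set xi := d *: w + z in w'xi.
have d2 : d * d = 1 by case: dP => ->; ring.
have zw : hform z w = 0 by rewrite hformC.
have xi0 : hform xi xi = 0 by rewrite /xi !hformE ww zz zw wz0 mulr1 d2; ring.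
have xiw : hform xi w = d by rewrite /xi !hformE ww zw; ring.
have dN : d != 0 by apply/eqP => d0; move: d2; rewrite d0 mul0r; lra.
have xiN : xi != 0.
  apply: contra dN => /eqP E; rewrite -xiw E; apply/eqP.
  by rewrite -(scale0r (0 : 'cV[R]_n.+1)) hformZl mul0r.
have := dev_ideal wW' w'y xi0 xiN w'xi.
(* Since [w'] is the next lift, only [w] and [w'] can contribute to the crossing from [x] to [y]. *)
have sP : separators x y [:: w; w'].
  split; first by rewrite /= inE eq_sym ne.
    by move=> u; rewrite !inE => /orP[]/eqP->.
  move=> u uW; rewrite !inE; apply: contraR; rewrite negb_or => /andP[u1 u2].
  by apply/eqP/jump_eq0/sep.
rewrite (dev_crossing _ xP yP) (ev_crossing xP yP sP xi0) !big_cons big_nil.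
(* The term of [w'] vanishes as [xi] is orthogonal to [w'] and [k] is positive; the equation left is
   [d ^+ k * (ev (dev x) (w + x) + (0 < e)) = 0]. *)
rewrite (hformC xi w') w'xi xiw expr0n gtn_eqF // mulr0 !addr0 (dev_const wW wx wz dP).
rewrite /jump wx0 ltxx subr0.
have -> : (0 < hform w y) = (0 < e).
  case: eP ey => -> ey; first by rewrite mul1r in ey; rewrite ey ltr01.
  by apply/idP/idP; lra.
rewrite [X in _ + X]mulrC -mulrDr => /eqP; rewrite mulf_eq0 expf_eq0 (negbTE dN) andbF /=.
by rewrite addr_eq0 => /eqP.
Qed.

Lemma coboundary_absurd : False.
Proof.
have [x vx] := hplane_inhabited vv.
have := dev_side (or_introl erefl) wall_self vx.
rewrite (dev_side (or_intror erefl) wall_self vx) ltr01.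
have -> : (0 < -1 :> R) = false by rewrite oppr_gt0 ltr10.
by rewrite oppr0 => /eqP; rewrite eq_sym oppr_eq0 oner_eq0.
Qed.

End Coboundary.
End Walls.

Theorem theorem5p6 (R : realType) (n : nat) (G : 'M[R]_n.+1 -> Prop) :
  (2 <= n)%N ->
  is_subgroup G -> (forall g, G g -> in_SOo g) ->
  discrete_set G -> torsion_free G -> cocompact G ->
  has_tg_hypersurface G ->
  forall k : nat, (1 <= k)%N -> H1_nonzero G k.
Proof.
move=> n2 Gsub GSO Gdisc _ Gcoc [v [vv [emb [cpt ori]]]] k k1.
have [T [TS evT TG]] := zonal R n k.
have [F FP] := sepfun_exists n2 Gsub GSO Gdisc cpt ori.
have [x0 [x0P _]] := hplane_inhabited vv.
have GHn g x : G g -> Hn x -> Hn (g *m x) by move=> /GSO[_]; apply.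
exists (fun g => crossing T F x0 (g *m x0)); split; first by move=> g _; apply: crossing_S0.
split=> [g h Gg Gh|[T0 _ T0P]].
  have hx0 := GHn _ _ Gh x0P.
  (* The cocycle identity splits the way from [x0] to [g *m (h *m x0)] at [g *m x0]. *)
  rewrite -mulmxA (crossingD T FP x0P (GHn _ _ Gg x0P) (GHn _ _ Gg hx0)).
  apply: funext => I; congr (_ + _).
  by rewrite (crossing_act Gsub GSO TG FP).
exact: (coboundary_absurd n2 Gsub GSO Gdisc Gcoc vv emb cpt ori k1 evT TG FP x0P T0P).
Qed.
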